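(* Let $\mathbb{D} = \{x \in \mathbb{R}^2 : \|x\| \leq 1\}$ be the unit disk. For every real $L > 0$ there exists a rectifiable set $S \subset \mathbb{D}$ with total length $\mathcal{H}^1(S) = L$ such that for every line $\ell$ in $\mathbb{R}^2$ $$ \left| \#(\ell \cap S) - \frac{2L}{\pi^2}\, \mathcal{H}^1(\ell \cap \mathbb{D}) \right| \leq 100. $$
   Context: $\mathcal{H}^1$ denotes one-dimensional Hausdorff measure (length) in $\mathbb{R}^2$, and $\#(\ell \cap S)$ is the number of points of $\ell \cap S$ (possibly $\infty$). A set $S \subset \mathbb{R}^2$ is rectifiable if it is $\mathcal{H}^1$-measurable, $\mathcal{H}^1(S) < \infty$, and, up to an $\mathcal{H}^1$-null set, it is contained in a countable union of Lipschitz images of $\mathbb{R}$. Lines are full (infinite) straight lines in $\mathbb{R}^2$. *)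

(* Defs.v *)
From mathcomp Require Import all_boot all_order all_algebra.
From mathcomp Require Import all_classical all_reals all_analysis.

Set Implicit Arguments.
Unset Strict Implicit.
Unset Printing Implicit Defensive.

Import Order.TTheory GRing.Theory Num.Theory.

Local Open Scope classical_set_scope.
Local Open Scope ring_scope.

(* The library norm on [R * R] is the sup norm, hence this definition. *)
Definition enorm (R : realType) (p : R * R) : R :=
  Num.sqrt (p.1 ^+ 2 + p.2 ^+ 2).

(* [maxe 0] is only there for the empty set, since [ereal_sup set0 = -oo]. *)
Definition diam (R : realType) (A : set (R * R)) : \bar R :=
  maxe 0%E (ereal_sup [set (enorm (p.1 - p.2))%:E | p in A `*` A]).

Definition delta_cover (R : realType) (delta : R) (A : set (R * R))
    (F : nat -> set (R * R)) : Prop :=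
  A `<=` \bigcup_k F k /\ forall k, (diam (F k) <= delta%:E)%E.

Definition hausdorff1_pre (R : realType) (delta : R) (A : set (R * R)) :
    \bar R :=
  ereal_inf [set (\sum_(0 <= k <oo) diam (F k))%E
            | F in [set F | delta_cover delta A F]].

(* In dimension one the sum of the diameters needs no normalizing constant:
   the measure of a segment is its length. *)
Definition hausdorff1 (R : realType) (A : set (R * R)) : \bar R :=
  ereal_sup [set hausdorff1_pre delta A | delta in [set d : R | 0 < d]].

Definition elipschitz (R : realType) (f : R -> R * R) : Prop :=
  exists k : R, forall s t : R, enorm (f s - f t) <= k * `|s - t|.

Definition rectifiable (R : realType) (S : set (R * R)) : Prop :=
  [/\ (@hausdorff1 R).-caratheodory S,
      (hausdorff1 S < +oo)%E &
      exists f : nat -> R -> R * R,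
        (forall i, elipschitz (f i)) /\
        hausdorff1 (S `\` \bigcup_i range (f i)) = 0%E].

Definition unit_disk (R : realType) : set (R * R) :=
  [set p | enorm p <= 1].
Arguments unit_disk R : clear implicits.

Definition is_line (R : realType) (l : set (R * R)) : Prop :=
  exists p v : R * R,
    v != 0 /\ l = range (fun t : R => (p.1 + t * v.1, p.2 + t * v.2)).

(* Main.v *)
From HB Require Import structures.
Require Import Defs.
From mathcomp Require Import all_boot all_order all_algebra.
From mathcomp Require Import all_classical all_reals all_analysis.
From mathcomp Require Import ring lra.

(** The set S is a finite union of circles centred at the origin.  A line at
    distance d from the origin meets a circle of radius r in two points if
    d < r, in one if d = r and in none if d > r, and it meets the disk in a
    chord of length 2 sqrt (1 - d^2).  With a = 2 L / pi^2, it thus suffices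
    that the number of radii exceeding d be a sqrt (1 - d^2) up to a bounded
    error, for every d >= 0.

    The radii with this property are sampled from the decreasing function
    x |-> sqrt (1 - (x / a)^2) on [0, a], one for each unit interval: at most
    one radius is lost or gained.  Sampling by mean values makes the sum of the
    radii equal to the integral a pi / 4 of that function, so that the total
    length 2 pi (a pi / 4) is exactly L and needs no later correction.  As the
    integral has the primitive t |-> (t + sin t cos t) / 2 in the variable
    x = a sin t, the mean values are difference quotients and the mean value
    theorem replaces integration ([cap_area_slope],
    [equidistributed_radii]).  For a line with chord 2 N / a, where
    m <= N < m + 1, the count lies between 2 m and 2 m + 2
    ([counting_line_ge], [counting_line_le]), so that the error is at most 2.

    The measure theory consists of the exact lengths of segments and circles
    and of the measurability of circles.  Upper bounds come from cutting a
    Lipschitz curve into short arcs ([hausdorff1_image_le]).  Lower bounds come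
    from pulling a cover back to the parameter interval and using Lebesgue
    measure there ([hausdorff1_image_ge]); for circles this loses a factor that
    tends to 1 with the mesh, because short chords are almost as long as their
    arcs.  Additivity over disjoint circles holds because they lie at positive
    distance ([hausdorff1_separated]), and the same fact gives Caratheodory's
    criterion for sublevel sets of nonexpansive functions
    ([caratheodory_sublevel]), of which circles are intersections. *)

Set Implicit Arguments.
Unset Strict Implicit.
Unset Printing Implicit Defensive.

Import Order.TTheory GRing.Theory Num.Theory.
Import numFieldNormedType.Exports.

Local Open Scope classical_set_scope.
Local Open Scope ring_scope.

(** * The Euclidean norm and diameters *)

Section enorm.
Context {R : realType}.
Implicit Types p q : R * R.

Lemma enorm_ge0 p : 0 <= enorm p.
Proof. exact: sqrtr_ge0. Qed.

Lemma sqr_enorm p : enorm p ^+ 2 = p.1 ^+ 2 + p.2 ^+ 2.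
Proof. by rewrite sqr_sqrtr// addr_ge0// sqr_ge0. Qed.

Lemma enormP p c : 0 <= c -> p.1 ^+ 2 + p.2 ^+ 2 = c ^+ 2 -> enorm p = c.
Proof. by move=> c0 pc; rewrite /enorm pc sqrtr_sqr ger0_norm. Qed.

(** The one-sided form is equivalent to being 1-Lipschitz by symmetry. *)
Definition nonexpansive (f : R * R -> R) :=
  forall p q, f p - f q <= enorm (p - q).

Lemma nonexpansive_enorm : nonexpansive (@enorm R).
Proof.
move=> p q; rewrite lerBlDr -ler_sqr ?nnegrE ?addr_ge0 ?enorm_ge0//.
rewrite sqrrD !sqr_enorm/=.
(* Cauchy-Schwarz for [p - q] and [q]. *)
have CS : (p.1 - q.1) * q.1 + (p.2 - q.2) * q.2 <= enorm (p - q) * enorm q.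
  apply: le_trans (ler_norm _) _.
  rewrite -ler_sqr ?nnegrE ?mulr_ge0 ?enorm_ge0// exprMn !sqr_enorm/=.
  rewrite real_normK ?num_real//.
  by have := sqr_ge0 ((p.1 - q.1) * q.2 - (p.2 - q.2) * q.1); nra.
nra.
Qed.

Lemma nonexpansive_snd : nonexpansive snd.
Proof.
move=> p q; apply: le_trans (ler_norm _) _.
rewrite -ler_sqr ?nnegrE ?enorm_ge0// sqr_enorm/= real_normK ?num_real//.
by rewrite lerDr sqr_ge0.
Qed.

Lemma nonexpansiveN f : nonexpansive f -> nonexpansive (\- f).
Proof.
move=> nf p q /=; rewrite opprK addrC (le_trans (nf _ _))//.
by rewrite /enorm/= -(sqrrN (q.1 - _)) -(sqrrN (q.2 - _)) !opprB.
Qed.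

End enorm.

Section diam.
Context {R : realType}.
Implicit Types A B : set (R * R).
Local Open Scope ereal_scope.

Lemma diam_ge0 A : 0 <= diam A.
Proof. by rewrite /diam le_max lexx. Qed.

Lemma enorm_le_diam A p q : A p -> A q -> (enorm (p - q))%:E <= diam A.
Proof.
move=> Ap Aq; rewrite /diam le_max; apply/orP; right.
by apply: ereal_sup_ubound; exists (p, q).
Qed.

Lemma diam_le A (c : R) : (0 <= c)%R ->
  (forall p q, A p -> A q -> (enorm (p - q) <= c)%R) -> diam A <= c%:E.
Proof.
move=> c0 Ac; rewrite /diam ge_max lee_fin c0/=.
by apply: ge_ereal_sup => _ [[p q] [/= Ap Aq] <-]; rewrite lee_fin Ac.
Qed.

Lemma le_diam A B : A `<=` B -> diam A <= diam B.
Proof.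
move=> AB; rewrite {1}/diam ge_max diam_ge0/=.
by apply: ge_ereal_sup => _ [[p q] [/= Ap Aq] <-]; apply: enorm_le_diam; exact: AB.
Qed.

Lemma diam0 : diam set0 = 0 :> \bar R.
Proof. by apply/eqP; rewrite eq_le diam_ge0 andbT; exact: diam_le. Qed.

End diam.

(** * Hausdorff measure as a metric outer measure *)

(** The plane with every subset measurable: on this copy the outer measure
    generated by a set function ranges over all countable covers, as in
    Hausdorff's construction. *)
Definition discrete_plane (R : realType) : Type := (R * R)%type.

HB.instance Definition _ (R : realType) := Choice.on (discrete_plane R).
HB.instance Definition _ (R : realType) :=
  isPointed.Build (discrete_plane R) (0, 0).
HB.instance Definition _ (R : realType) :=
  @isMeasurable.Build default_measure_display (discrete_plane R)
    discrete_measurable discrete_measurable0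
    discrete_measurableC discrete_measurableU.

Section outer_measure.
Context {R : realType}.
Implicit Types (A B X Y : set (R * R)) (d : R).
Local Open Scope ereal_scope.

(** The infinite value excludes sets of diameter above [d] from covers without
    any restriction on the covers themselves. *)
Definition small_diam d (A : set (discrete_plane R)) : \bar R :=
  if diam A <= d%:E then diam A else +oo.

Lemma small_diam_ge0 d A : 0 <= small_diam d A.
Proof. by rewrite /small_diam; case: ifP; rewrite ?diam_ge0. Qed.

Lemma small_diam0 d : (0 < d)%R -> small_diam d set0 = 0.
Proof. by move=> d0; rewrite /small_diam diam0 lee_fin ltW. Qed.

Lemma hausdorff1_preE d A :
  hausdorff1_pre d A = mu_ext (T := discrete_plane R) (small_diam d) A.
Proof.
apply/eqP; rewrite eq_le; apply/andP; split.
- apply: le_ereal_inf_tmp => _ [F [_ AF] <-].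
  have [Fd|/existsNP[k /negP Fk]] := pselect (forall k, diam (F k) <= d%:E).
    apply: ereal_inf_lbound; exists F; first by split.
    by apply: eq_eseriesr => k _; rewrite /small_diam Fd.
  rewrite (@nneseries_pinfty _ _ _ k) ?leey//.
    by move=> n _; exact: small_diam_ge0.
  by rewrite /small_diam (negbTE Fk).
- apply: le_ereal_inf_tmp => _ [F [AF Fd] <-].
  apply: ereal_inf_lbound; exists F.
    by split.
  by apply: eq_eseriesr => k _; rewrite /small_diam Fd.
Qed.

Lemma hausdorff1_pre_ge0 d A : 0 <= hausdorff1_pre d A.
Proof. by rewrite hausdorff1_preE mu_ext_ge0//; exact: small_diam_ge0. Qed.

Lemma le_hausdorff1_pre d A B :
  A `<=` B -> hausdorff1_pre d A <= hausdorff1_pre d B.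
Proof. by rewrite !hausdorff1_preE; exact: (@le_mu_ext _ (discrete_plane R)). Qed.

Lemma hausdorff1_pre_anti d d' A : (d <= d')%R ->
  hausdorff1_pre d' A <= hausdorff1_pre d A.
Proof.
move=> dd'; apply: ereal_inf_le_tmp => _ [F [AF Fd] <-]; exists F => //.
by split=> // k; rewrite (le_trans (Fd k))// lee_fin.
Qed.

Lemma hausdorff1_pre_le d A : (0 < d)%R -> hausdorff1_pre d A <= hausdorff1 A.
Proof. by move=> d0; apply: ereal_sup_ubound; exists d. Qed.

(** Only small scales matter, since [hausdorff1_pre] grows as the scale
    shrinks. *)
Lemma hausdorff1_le e A x : (0 < e)%R ->
  (forall d, (0 < d <= e)%R -> hausdorff1_pre d A <= x) -> hausdorff1 A <= x.
Proof.
move=> e0 Ax; apply: ge_ereal_sup => _ [d /= d0 <-].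
apply: le_trans (Ax (Num.min d e) _).
  by apply: hausdorff1_pre_anti; rewrite ge_min lexx.
by rewrite lt_min d0 e0 ge_min lexx orbT.
Qed.

Lemma hausdorff1_ge0 A : 0 <= hausdorff1 A.
Proof. exact: le_trans (hausdorff1_pre_ge0 1 A) (hausdorff1_pre_le _ _). Qed.

Lemma hausdorff1_set0 : hausdorff1 set0 = 0 :> \bar R.
Proof.
apply/eqP; rewrite eq_le hausdorff1_ge0 andbT.
apply: (@hausdorff1_le 1%R) => // d /andP[d0 _].
rewrite hausdorff1_preE mu_ext0//; first exact: small_diam0.
exact: small_diam_ge0.
Qed.

Lemma le_hausdorff1 : {homo @hausdorff1 R : A B / A `<=` B >-> A <= B}.
Proof.
move=> A B AB; apply: (@hausdorff1_le 1%R) => // d /andP[d0 _].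
exact: le_trans (le_hausdorff1_pre d AB) (hausdorff1_pre_le _ _).
Qed.

Lemma hausdorff1_sigma_subadditive : sigma_subadditive (@hausdorff1 R).
Proof.
move=> F; apply: (@hausdorff1_le 1%R) => // d /andP[d0 _].
rewrite hausdorff1_preE.
apply: (le_trans (mu_ext_sigma_subadditive (T := discrete_plane R)
  (small_diam_ge0 d) F)).
apply: lee_nneseries => k _.
  by move=> _; apply: mu_ext_ge0; exact: small_diam_ge0.
by rewrite -hausdorff1_preE; exact: hausdorff1_pre_le.
Qed.

HB.instance Definition _ := isOuterMeasure.Build R (R * R)%type (@hausdorff1 R)
  hausdorff1_set0 hausdorff1_ge0 le_hausdorff1 hausdorff1_sigma_subadditive.

(** A set of diameter less than [b - a] cannot meet both [X] and [Y], so that a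
    fine cover of the union splits into a cover of each at no extra cost. *)
Lemma hausdorff1_separated (f : R * R -> R) (a b : R) X Y :
  nonexpansive f -> (a < b)%R ->
  X `<=` [set p | f p <= a]%R -> Y `<=` [set p | b <= f p]%R ->
  hausdorff1 X + hausdorff1 Y <= hausdorff1 (X `|` Y).
Proof.
move=> nf ab Xa Yb.
have pre_le d : (0 < d < b - a)%R ->
    hausdorff1_pre d X + hausdorff1_pre d Y <= hausdorff1_pre d (X `|` Y).
  move=> /andP[d0 dab]; apply: le_ereal_inf_tmp => _ [F [XYF Fd] <-].
  have split_diam k : diam (F k `&` X) + diam (F k `&` Y) <= diam (F k).
    have [[x [Fx Xx]]|X0] := pselect (F k `&` X !=set0); last first.
      have -> : F k `&` X = set0 by apply/eqP/negPn/negP => /set0P.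
      by rewrite diam0 add0e; apply: le_diam; exact: subIsetl.
    suff -> : F k `&` Y = set0.
      by rewrite diam0 adde0; apply: le_diam; exact: subIsetl.
    apply/eqP/negPn/negP => /set0P[y [Fy Yy]].
    have := le_trans (enorm_le_diam Fy Fx) (Fd k); rewrite lee_fin.
    have := nf y x; have := Xa _ Xx; have := Yb _ Yy => /=; lra.
  have preX Z : Z `<=` \bigcup_k F k ->
      hausdorff1_pre d Z <= \sum_(0 <= k <oo) diam (F k `&` Z).
    move=> ZF; apply: ereal_inf_lbound; exists (fun k => F k `&` Z) => //.
    split=> [p Zp|k]; first by have [k _ Fp] := ZF _ Zp; exists k.
    by rewrite (le_trans _ (Fd k))//; apply: le_diam; exact: subIsetl.
  apply: le_trans (leeD (preX X _) (preX Y _)) _.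
  - by move=> p Xp; apply: XYF; left.
  - by move=> p Yp; apply: XYF; right.
  rewrite -nneseriesD//; do ?by move=> i _ _; exact: diam_ge0.
  by apply: lee_nneseries => // k _ ; rewrite adde_ge0 ?diam_ge0.
(* Finiteness of the right-hand side lets the two suprema be taken in turn. *)
have [->|Zfin] := eqVneq (hausdorff1 (X `|` Y)) +oo; first by rewrite leey.
have ? : hausdorff1 (X `|` Y) \is a fin_num.
  by rewrite ge0_fin_numE ?hausdorff1_ge0// ltey.
have finW W : W `<=` X `|` Y -> hausdorff1 W \is a fin_num.
  move=> WXY; rewrite ge0_fin_numE ?hausdorff1_ge0//.
  by rewrite (le_lt_trans (le_hausdorff1 WXY))// ltey.
have e0 : (0 < (b - a) / 2)%R by rewrite divr_gt0// subr_gt0.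
have small d : (0 < d <= (b - a) / 2 -> 0 < d < b - a)%R by move=> /andP[]; lra.
rewrite -leeBrDr; last by apply: finW; exact: subsetUr.
apply: (hausdorff1_le e0) => d /[dup] /andP[d0 de] /small dab.
rewrite leeBrDr; last by apply: finW; exact: subsetUr.
have finX : hausdorff1_pre d X \is a fin_num.
  rewrite ge0_fin_numE ?hausdorff1_pre_ge0//
    (le_lt_trans (hausdorff1_pre_le _ d0))//.
  by rewrite -ge0_fin_numE ?hausdorff1_ge0//; apply: finW; exact: subsetUl.
rewrite addeC -leeBrDr//.
apply: (hausdorff1_le d0) => d' /andP[d'0 d'd]; rewrite leeBrDr// addeC.
apply: le_trans (leeD2r _ (hausdorff1_pre_anti _ d'd)) _.
apply: le_trans (pre_le d' _) (hausdorff1_pre_le _ _) => //.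
by apply: small; rewrite d'0 (le_trans d'd).
Qed.

(** Caratheodory's criterion.  The part of [X] where [f >= c + 1/(n+1)] is
    separated from the part where [f <= c]; what remains is a union of thin
    shells.  Shells of index [k] and [k + 2] are separated, so the sum of all
    shell measures is at most twice the measure of [X] and its tails tend
    to 0. *)
Lemma caratheodory_sublevel (f : R * R -> R) (c : R) : nonexpansive f ->
  (@hausdorff1 R).-caratheodory [set p | f p <= c]%R.
Proof.
move=> nf; apply: le_caratheodory_measurable => X.
set A := [set p | _]; pose H := @hausdorff1 R.
have [Xoo|Xfin] := eqVneq (H X) +oo; first by rewrite [leRHS]Xoo leey.
have finH Y : Y `<=` X -> H Y = (fine (H Y))%:E.
  move=> YX; rewrite fineK// ge0_fin_numE ?hausdorff1_ge0//.
  by rewrite (le_lt_trans (le_hausdorff1 YX))// ltey.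
pose e k : R := (c + k.+1%:R^-1)%R.
have lte_e k l : (k < l)%N -> (e l < e k)%R.
  by move=> kl; rewrite ltrD2l ltf_pV2 ?posrE// ltr_nat.
pose U k := X `&` [set p | e k <= f p]%R.
pose D k := X `&` [set p | f p <= e k]%R.
pose shell k := X `&` [set p | e k.+1 <= f p <= e k]%R.
have shell_le k :
    (fine (H (D k.+2)) + fine (H (shell k)) <= fine (H (D k)))%R.
  rewrite -lee_fin EFinD -!finH; do ?exact: subIsetl.
  apply: le_trans (hausdorff1_separated nf (lte_e k.+1 k.+2 _) _ _) _ => //.
  - by move=> p [].
  - by move=> p [_ /= /andP[]].
  - apply: le_hausdorff1 => p [[Xp /= fp]|[Xp /= /andP[_ fp]]]; split => //=.
    by rewrite (le_trans fp)// ltW// lte_e.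
have shell_sum n : \sum_(0 <= k < n) H (shell k) <=
    (fine (H (D 0%N)) + fine (H (D 1%N)))%R%:E.
  (* [shell_le] bounds each term by a difference at distance two, so that the
     sum telescopes to two initial and two final terms. *)
  suff : (\sum_(0 <= k < n) fine (H (shell k)) +
      (fine (H (D n)) + fine (H (D n.+1))) <= fine (H (D 0%N)) + fine (H (D 1%N)))%R.
    move=> bnd; rewrite (eq_bigr (fun k => (fine (H (shell k)))%:E)); last first.
      by move=> k _; apply: finH; exact: subIsetl.
    rewrite sumEFin lee_fin (le_trans _ bnd)// lerDl.
    by rewrite addr_ge0 ?fine_ge0 ?hausdorff1_ge0.
  elim: n => [|n ih]; first by rewrite big_nil add0r.
  by rewrite big_nat_recr//=; have := shell_le n; lra.
have shell_fin : \sum_(0 <= k <oo) H (shell k) < +oo.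
  apply: le_lt_trans (ltry (fine (H (D 0%N)) + fine (H (D 1%N)))%R).
  apply: lime_le; last by apply: nearW => n; exact: shell_sum.
  by apply: is_cvg_nneseries => k _ _; exact: hausdorff1_ge0.
have tail0 := nneseries_tail_cvg shell_fin (fun k _ => hausdorff1_ge0 (shell k)).
have cover n : X `&` ~` A `<=` U n `|` \bigcup_(k in ~` `I_n) shell k.
  move=> p [Xp /= /negP]; rewrite -ltNge => cfp.
  have [en|en] := leP (e n) (f p); [by left|right].
  have [m em] := ltr_add_invr cfp.
  have [k ekp kmin] := ex_minnP (ex_intro (fun k => e k <= f p)%R m (ltW em)).
  have nk : (n < k)%N.
    rewrite ltnNge; apply/negP => kn.
    have : (e n <= e k)%R.
      by move: kn; rewrite leq_eqVlt => /predU1P[->//|/lte_e/ltW].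
    by rewrite leNgt (le_lt_trans ekp en).
  case: k nk ekp kmin => // k nk ekp kmin; exists k.
    by apply/negP; rewrite -leqNgt.
  split=> //=; rewrite ekp/= leNgt; apply/negP => /ltW /kmin.
  by rewrite ltnn.
apply/lee_addgt0Pr => x x0.
have [n tailn] : exists n, \sum_(n <= k <oo) H (shell k) < x%:E.
  apply: contrapT => /forallNP tail_ge.
  suff : x%:E <= 0 by rewrite lee_fin leNgt x0.
  apply: cvge_to_ge tail0 _; apply: nearW => n.
  by rewrite leNgt; apply/negP; exact: tail_ge.
apply: le_trans (leeD2l _ (le_outer_measure H _ _ (@cover n))) _.
apply: le_trans (leeD2l _ (outer_measureU2 H _ _)) _.
rewrite addeA; apply: leeD; last first.
  apply: le_trans (ltW tailn).
  exact: (outer_measure_sigma_subadditive_tail (@hausdorff1 R)).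
have en : (c < e n)%R by rewrite ltrDl invr_gt0.
apply: (@le_trans _ _ (H (X `&` A `|` U n))).
  by apply: (hausdorff1_separated nf en) => p [].
by apply: le_hausdorff1 => p [[]|[]].
Qed.

End outer_measure.

(** * Lengths of parametrized curves *)

Section images.
Context {R : realType}.
Implicit Types (g : R -> R * R) (a b c : R).

Lemma hausdorff1_image_le g (k : R) a b : a <= b -> 0 <= k ->
  (forall s t, enorm (g s - g t) <= k * `|s - t|) ->
  (hausdorff1 (g @` `[a, b]) <= (k * (b - a))%:E)%E.
Proof.
move=> ab k0 gk; have kab : 0 <= k * (b - a) by rewrite mulr_ge0// subr_ge0.
apply: (@hausdorff1_le _ 1) => // d /andP[d0 _].
set n := Num.bound (k * (b - a) / d).
have nd : k * (b - a) <= n.+1%:R * d.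
  rewrite -ler_pdivrMr//; apply: le_trans (ltW (archi_boundP _)) _.
    by rewrite divr_ge0// ltW.
  by rewrite ler_nat.
pose h := (b - a) / n.+1%:R.
have h0 : 0 <= h by rewrite divr_ge0// subr_ge0.
have khd : k * h <= d by rewrite mulrA ler_pdivrMr// [d * _]mulrC.
pose F i := if (i <= n)%N then g @` `[a + i%:R * h, a + i.+1%:R * h] else set0.
have diamF i : (diam (F i) <= if (i <= n)%N then (k * h)%:E else 0)%E.
  rewrite /F; case: ifP => _; last by rewrite diam0.
  apply: diam_le; first by rewrite mulr_ge0.
  move=> _ _ [s /= + <-] [t /= + <-]; rewrite !in_itv/= => /andP[s1 s2] /andP[t1 t2].
  apply: le_trans (gk _ _) _; apply: ler_wpM2l => //.
  by rewrite ler_norml; move: s1 s2 t1 t2; rewrite -natr1; lra.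
apply: (@le_trans _ _ (\sum_(0 <= i <oo) diam (F i))%E).
  apply: ereal_inf_lbound; exists F => //; split=> [_ [t /= + <-]|i].
    rewrite in_itv/= => /andP[ta tb].
    have tn : t <= a + n.+1%:R * h by rewrite mulrC divfK ?pnatr_eq0//; lra.
    have [i ti imin] := ex_minnP (ex_intro (fun i => t <= a + i.+1%:R * h) n tn).
    exists i => //; rewrite /F (imin _ tn); exists t => //=.
    rewrite in_itv/= ti andbT.
    case: i ti imin => [|i] _ imin; first by rewrite mul0r addr0.
    by rewrite leNgt; apply/negP => /ltW /imin; rewrite ltnn.
  by apply: le_trans (diamF i) _; case: ifP => _; rewrite lee_fin// ltW.
rewrite (nneseries_split _ n.+1); last by move=> i _; exact: diam_ge0.
rewrite [X in (_ + X)%E]eseries0; last first.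
  by move=> i; rewrite add0n /F => ni _; rewrite leqNgt ni diam0.
rewrite adde0 add0n.
apply: (@le_trans _ _ (\sum_(0 <= i < n.+1) (k * h)%:E)%E).
  rewrite big_nat [leRHS]big_nat; apply: lee_sum => i /andP[_ ni].
  by apply: le_trans (diamF i) _; rewrite -ltnS ni.
rewrite sumEFin sumr_const_nat subn0 lee_fin -mulr_natl mulrCA.
by rewrite [_%:R * _]mulrC divfK ?pnatr_eq0.
Qed.

(** The parameters sent into a set of diameter [D] lie in an interval of length
    [D / c], so that a cover of the curve by small sets yields a cover of
    [`]a, b[] by intervals.  The expansion hypothesis is local in the image
    because covers are fine: this is what allows [c] to be close to the exact
    speed of a curved arc. *)
Lemma hausdorff1_image_ge g c (e : R) a b : a <= b -> 0 < c -> 0 < e ->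
  (forall s t, a < s < b -> a < t < b ->
    enorm (g s - g t) <= e -> c * `|s - t| <= enorm (g s - g t)) ->
  ((c * (b - a))%:E <= hausdorff1 (g @` `]a, b[))%E.
Proof.
move=> ab c0 e0 ge_c; apply: le_trans (hausdorff1_pre_le _ e0).
apply: le_ereal_inf_tmp => _ [F [gF Fe] <-].
pose T k := [set t | a < t < b /\ F k (g t)].
have diamF k : diam (F k) = (fine (diam (F k)))%:E.
  rewrite fineK// ge0_fin_numE ?diam_ge0//.
  by rewrite (le_lt_trans (Fe k))// ltry.
pose l k := fine (diam (F k)) / c.
have Tl k s t : T k s -> T k t -> s - l k <= t.
  move=> [sab Fs] [tab Ft]; have := enorm_le_diam Fs Ft.
  rewrite diamF lee_fin => st.
  have ste : enorm (g s - g t) <= e.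
    by rewrite -lee_fin (le_trans _ (Fe k))// diamF lee_fin.
  have := le_trans (ge_c s t sab tab ste) st.
  rewrite mulrC -ler_pdivlMr// -/(l k) => /(le_trans (ler_norm _)); lra.
pose I k : set R := [set` `[sup (T k) - l k, sup (T k)]].
have TI k : T k `<=` I k.
  move=> t Tt; rewrite /I/= in_itv/=; apply/andP; split.
    rewrite lerBlDr; apply: ge_sup; first by exists t.
    by move=> s Ts; rewrite -lerBlDr; exact: Tl.
  apply: ub_le_sup => //; exists (t + l k) => s Ts.
  by rewrite -lerBlDr; exact: Tl.
have lI k : lebesgue_measure (I k) = (c^-1%:E * diam (F k))%E.
  have l0 : 0 <= l k by rewrite divr_ge0 ?fine_ge0 ?diam_ge0// ltW.
  rewrite /I lebesgue_measure_itv/= lte_fin diamF -EFinM -EFinB.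
  have -> : sup (T k) - (sup (T k) - l k) = c^-1 * fine (diam (F k)).
    by rewrite /l; ring.
  case: ifPn => //; rewrite -leNgt => sl; congr EFin.
  by apply/eqP; rewrite eq_le mulrC l0/= -/(l k); move: sl; lra.
have : (lebesgue_measure ([set` `]a, b[] : set R) <=
    \sum_(0 <= k <oo) lebesgue_measure (I k))%E.
  apply: (@measure_sigma_subadditive _ _ _ (@lebesgue_measure R)) => //.
  - move=> k; exact: measurable_itv.
  - move=> t /= tab; have [|k _ Fk] := gF (g t); first by exists t.
    by exists k => //; apply: TI; split => //; move: tab; rewrite in_itv.
under eq_eseriesr do rewrite lI.
rewrite nneseriesZl; last by move=> k _; exact: diam_ge0.
rewrite lebesgue_measure_itv/= lte_fin -EFinB => len.
have {}len : ((b - a)%:E <= c^-1%:E * \sum_(0 <= k <oo) diam (F k))%E.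
  move: ab; rewrite le_eqVlt => /predU1P[->|ab]; last by move: len; rewrite ab.
  rewrite subrr mule_ge0 ?lee_fin ?invr_ge0 ?(ltW c0)//.
  by apply: nneseries_ge0 => k _ _; exact: diam_ge0.
by rewrite EFinM muleC -lee_pdivlMr// muleC.
Qed.

End images.

(** * Circles *)

Section circle.
Context {R : realType}.
Implicit Types r s t u : R.

Definition circle r := [set p : R * R | enorm p = r].

Definition circle_param r t : R * R := (r * cos t, r * sin t).

Lemma chord_length r s t : 0 <= r ->
  enorm (circle_param r s - circle_param r t) = 2 * r * `|sin ((s - t) / 2)|.
Proof.
move=> r0; apply: enormP; first by rewrite !mulr_ge0.
rewrite [RHS]exprMn real_normK ?num_real//=.
set u := (s - t) / 2; pose m := (s + t) / 2.
have -> : s = m + u by rewrite /m /u; field.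
have -> : t = m - u by rewrite /m /u; field.
have := cos2Dsin2 m => cs.
rewrite cosD cosB sinD sinB.
transitivity ((2 * r) ^+ 2 * sin u ^+ 2 * (cos m ^+ 2 + sin m ^+ 2)); first by ring.
by rewrite cs mulr1.
Qed.

Lemma sin_MVT u : 0 <= u -> exists2 x, 0 <= x <= u & sin u = u * cos x.
Proof.
move=> u0.
have [|x] := @MVT_segment R sin cos 0 u u0 (fun x _ => is_derive_sin x).
  by apply: continuous_subspaceT; exact: continuous_sin.
by rewrite in_itv/= sin0 !subr0 => x0u ->; exists x => //; rewrite mulrC.
Qed.

Lemma norm_sin_le u : `|sin u| <= `|u|.
Proof.
wlog u0 : u / 0 <= u => [h|].
  have [u0|/ltW u0] := leP 0 u; first exact: h.
  by rewrite -normrN -sinN -(normrN u) h// oppr_ge0.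
have [x _ ->] := sin_MVT u0.
by rewrite normrM ler_piMr// cos_max.
Qed.

Lemma sin_ge_mul_cos u : 0 <= u <= pi / 2 -> u * cos u <= sin u.
Proof.
move=> /andP[u0 upi]; have [x /andP[x0 xu] ->] := sin_MVT u0.
apply: ler_wpM2l => //; have pi0 := @pi_gt0 R.
rewrite leNgt ltr_cos ?in_itv/= -?leNgt//; lra.
Qed.

(** On a half circle a chord [2 r sin u] not exceeding [2 r sqrt (1 - c^2)]
    forces [cos u >= c], whence [sin u >= c u]: the arc is at most [1 / c] times
    the chord.  On a larger arc a short chord could also join two far ends. *)
Lemma hausdorff1_semicircle r s : 0 < r ->
  ((r * pi)%:E <= hausdorff1 (circle_param r @` `]s, (s + pi)%R[))%E.
Proof.
move=> r0; have pi0 := @pi_gt0 R.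
apply/lee_mul01Pr; first by rewrite lee_fin mulr_ge0// ltW.
move=> c /andP[c0 c1]; rewrite -EFinM mulrA.
have c2 : 0 < 1 - c ^+ 2 by nra.
pose e := 2 * r * Num.sqrt (1 - c ^+ 2).
have e0 : 0 < e by rewrite !mulr_gt0// sqrtr_gt0.
have -> : c * r * pi = c * r * (s + pi - s) by ring.
apply: (hausdorff1_image_ge _ _ e0); [lra|by rewrite mulr_gt0|].
move=> x y xs ys; rewrite (chord_length _ _ (ltW r0)).
rewrite /e ler_pM2l ?mulr_gt0// => sin_le.
set u := `|x - y| / 2.
have sin_abs : `|sin ((x - y) / 2)| = sin u.
  rewrite /u; have [xy|xy] := leP 0 (x - y).
    by rewrite (ger0_norm xy) ger0_norm//; apply: sin_ge0_pi; lra.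
  rewrite (ltr0_norm xy) -normrN -sinN -mulNr ger0_norm//.
  by apply: sin_ge0_pi; lra.
rewrite sin_abs in sin_le *.
have u_itv : 0 <= u <= pi / 2.
  rewrite divr_ge0//= ler_pM2r// ler_norml; lra.
have cosu0 : 0 <= cos u by rewrite cos_ge0_pihalf//; lra.
have c_le : c <= cos u.
  rewrite -ler_sqr ?nnegrE//; last exact: ltW.
  have sinu0 : 0 <= sin u by rewrite sin_ge0_pi//; lra.
  have : sin u ^+ 2 <= 1 - c ^+ 2.
    rewrite -[leRHS]sqr_sqrtr; last exact: ltW.
    by rewrite ler_sqr ?nnegrE ?sqrtr_ge0.
  by rewrite cos2sin2; lra.
have -> : c * r * `|x - y| = 2 * r * (u * c) by rewrite /u; field.
rewrite ler_pM2l ?mulr_gt0//.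
apply: le_trans (sin_ge_mul_cos u_itv).
by apply: ler_wpM2l => //; case/andP: u_itv.
Qed.

Lemma circle_param_lipschitz r s t : 0 <= r ->
  enorm (circle_param r s - circle_param r t) <= r * `|s - t|.
Proof.
move=> r0; rewrite chord_length//.
have := norm_sin_le ((s - t) / 2); rewrite normrM [`|2^-1|]ger0_norm//.
by nra.
Qed.

Lemma circle_paramP r t : 0 <= r -> circle r (circle_param r t).
Proof.
move=> r0; apply: enormP => //=.
by rewrite !exprMn -mulrDr cos2Dsin2 mulr1.
Qed.

Lemma circle_param_surj r p : 0 < r -> circle r p ->
  exists2 t, 0 <= t <= 2 * pi & circle_param r t = p.
Proof.
move=> r0 pr; have pi0 := @pi_gt0 R.
have := sqr_enorm p; rewrite pr => p2.
have p1r : -1 <= p.1 / r <= 1.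
  rewrite ler_pdivlMr// ler_pdivrMr// mulN1r mul1r -ler_norml.
  rewrite -ler_sqr ?nnegrE//; last exact: ltW.
  by rewrite real_normK ?num_real// p2 lerDl sqr_ge0.
set a := acos (p.1 / r).
have a_itv : 0 <= a <= pi by rewrite acos_ge0//= acos_lepi.
have cosa : r * cos a = p.1 by rewrite acosK ?in_itv//= mulrC divfK ?gt_eqF.
have sina : r * sin a = `|p.2|.
  have sina0 : 0 <= sin a by exact: sin_ge0_pi.
  apply/eqP; rewrite -(eqrXn2 (n := 2)) ?mulr_ge0 ?(ltW r0)//.
  rewrite real_normK ?num_real// exprMn sin2cos2 mulrBr mulr1 -exprMn cosa p2.
  by apply/eqP; ring.
have [p20|p20] := leP 0 p.2.
  exists a; first by lra.
  by rewrite /circle_param cosa sina ger0_norm//; case: (p).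
exists (2 * pi - a); first by lra.
have e2 : 2 * pi = pi *+ 2 :> R by rewrite mulr_natl.
rewrite /circle_param cosB sinB e2 cos2pi sin2pi !(mul0r, mul1r) addr0 add0r.
by rewrite mulrN cosa sina ltr0_norm// opprK; case: (p).
Qed.

Lemma hausdorff1_circle r : 0 < r ->
  hausdorff1 (circle r) = (2 * pi * r)%:E.
Proof.
move=> r0; have pi0 := @pi_gt0 R; apply/eqP; rewrite eq_le; apply/andP; split.
  apply: (@le_trans _ _ (hausdorff1 (circle_param r @` `[0%R, (2 * pi)%R]))).
    apply: le_hausdorff1 => p /(circle_param_surj r0)[t t_itv <-].
    by exists t => //=; rewrite in_itv.
  have -> : 2 * pi * r = r * (2 * pi - 0) by ring.
  apply: hausdorff1_image_le; [by rewrite mulr_ge0// ltW|exact: ltW|].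
  by move=> s t; apply: circle_param_lipschitz; exact: ltW.
(* The lower and the upper half circle each have length at least [r * pi];
   their lengths add up because a half-plane is measurable. *)
rewrite (caratheodory_sublevel 0 nonexpansive_snd (circle r)).
have -> : 2 * pi * r = r * pi + r * pi by ring.
rewrite EFinD; apply: leeD.
  apply: le_trans (hausdorff1_semicircle pi r0) _.
  apply: le_hausdorff1 => _ [t /= + <-]; rewrite in_itv/= => /andP[t1 t2].
  split; first by apply: circle_paramP; exact: ltW.
  rewrite /= pmulr_rle0//.
  have -> : t = (t - pi) + pi by ring.
  by rewrite sinDpi oppr_le0 sin_ge0_pi//; lra.
apply: le_trans (hausdorff1_semicircle 0 r0) _.
apply: le_hausdorff1 => _ [t /= + <-]; rewrite in_itv/= add0r => t_itv.
split; first by apply: circle_paramP; exact: ltW.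
by apply/negP; rewrite -ltNge /= mulr_gt0// sin_gt0_pi.
Qed.

Lemma caratheodory_circle r : (@hausdorff1 R).-caratheodory (circle r).
Proof.
have -> : circle r = [set p | enorm p <= r] `&` [set p | - enorm p <= - r].
  apply/seteqP; split => p /=; first by move=> ->; rewrite lexx.
  by rewrite lerN2 => -[? ?]; apply/eqP; rewrite eq_le; apply/andP.
apply: caratheodory_measurable_setI; apply: caratheodory_sublevel.
  exact: nonexpansive_enorm.
by apply: nonexpansiveN; exact: nonexpansive_enorm.
Qed.

Lemma hausdorff1_concentric (r : nat -> R) n :
  (forall k, (k < n)%N -> 0 < r k) ->
  (forall j k, (j < k < n)%N -> r k < r j) ->
  hausdorff1 (\bigcup_(k < n) circle (r k)) = (2 * pi * \sum_(0 <= k < n) r k)%:E.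
Proof.
elim: n => [|n ih] r0 r_dec.
  by rewrite bigcup_mkord !big_ord0 big_nil mulr0 outer_measure0.
rewrite big_nat_recr//= mulrDr EFinD -ih; last 2 first.
- by move=> k kn; apply: r0; rewrite ltnW.
- by move=> j k /andP[jk kn]; apply: r_dec; rewrite jk ltnW.
rewrite -hausdorff1_circle ?r0//.
have -> : \bigcup_(k < n.+1) circle (r k) =
    \bigcup_(k < n) circle (r k) `|` circle (r n).
  by rewrite !bigcup_mkord big_ord_recr.
apply/eqP; rewrite eq_le outer_measureU2/=.
case: n ih r0 r_dec => [|n] _ r0 r_dec.
  by rewrite bigcup_mkord big_ord0 outer_measure0 add0e set0U.
apply: (@hausdorff1_separated _ (\- @enorm R) (- r n) (- r n.+1)).
- exact/nonexpansiveN/nonexpansive_enorm.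
- by rewrite ltrN2 r_dec//= ltnSn ltnS leqnn.
- move=> p [k /= kn ->]; rewrite lerN2.
  move: kn; rewrite ltnS leq_eqVlt => /predU1P[->//|kn].
  by apply/ltW/r_dec; rewrite kn ltnS leqnSn.
- by move=> p /= ->.
Qed.

End circle.

(** * Lines and chords of the disk *)

Section line.
Context {R : realType}.

(** Parametrization by arc length from the foot of the perpendicular dropped
    from the origin; [d] is the distance from the origin to the line. *)
Lemma line_param (l : set (R * R)) : is_line l ->
  exists (g : R -> R * R) (d : R),
    [/\ 0 <= d, l = range g,
        forall s t, enorm (g s - g t) = `|s - t| &
        forall t, enorm (g t) ^+ 2 = d ^+ 2 + t ^+ 2].
Proof.
move=> [p [v [v0 ->]]].
have n0 : 0 < enorm v.
  rewrite lt_neqAle enorm_ge0 andbT; apply: contra v0 => /eqP ev.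
  have := sqr_enorm v; rewrite -ev expr0n/= => /esym/eqP.
  rewrite paddr_eq0 ?sqr_ge0// !sqrf_eq0 => /andP[/eqP v1 /eqP v2].
  by apply/eqP; case: (v) v1 v2 => a b /= -> ->.
have nv := sqr_enorm v; move: (enorm v) n0 nv => n n0 nv.
have [a [b [v1 v2]]] : exists a b, v.1 = a * n /\ v.2 = b * n.
  by exists (v.1 / n), (v.2 / n); rewrite !divfK// gt_eqF.
have ab1 : a ^+ 2 + b ^+ 2 = 1.
  apply: (mulfI (x := n ^+ 2)); first by rewrite expf_neq0// gt_eqF.
  by rewrite mulr1 [RHS]nv v1 v2; ring.
pose t0 := - (p.1 * a + p.2 * b).
pose q1 := p.1 + t0 * a; pose q2 := p.2 + t0 * b.
have qab : q1 * a + q2 * b = 0.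
  transitivity ((p.1 * a + p.2 * b) * (1 - (a ^+ 2 + b ^+ 2))).
    by rewrite /q1 /q2 /t0; ring.
  by rewrite ab1 subrr mulr0.
exists (fun t => (q1 + t * a, q2 + t * b)), (enorm (q1, q2)); split.
- exact: enorm_ge0.
- apply/seteqP; split => _ [t _ <-].
    exists (t * n - t0) => //.
    by congr pair; rewrite /q1 /q2 ?v1 ?v2; ring.
  exists ((t + t0) / n) => //.
  by congr pair; rewrite /q1 /q2 ?v1 ?v2; field; rewrite gt_eqF.
- move=> s t; apply: enormP => //; rewrite real_normK ?num_real//=.
  transitivity ((s - t) ^+ 2 * (a ^+ 2 + b ^+ 2)); first by ring.
  by rewrite ab1 mulr1.
- move=> t; rewrite !sqr_enorm/=.
  transitivity (q1 ^+ 2 + q2 ^+ 2 + 2 * t * (q1 * a + q2 * b)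
                + t ^+ 2 * (a ^+ 2 + b ^+ 2)); first by ring.
  by rewrite qab ab1 mulr0 addr0 mulr1.
Qed.

Lemma hausdorff1_segment (g : R -> R * R) (a b : R) : a <= b ->
  (forall s t, enorm (g s - g t) = `|s - t|) ->
  hausdorff1 (g @` `[a, b]) = (b - a)%:E.
Proof.
move=> ab giso; apply/eqP; rewrite eq_le; apply/andP; split.
  rewrite -[b - a]mul1r; apply: hausdorff1_image_le => // s t.
  by rewrite giso mul1r.
rewrite -[b - a]mul1r.
apply: (@le_trans _ _ (hausdorff1 (g @` `]a, b[))).
  apply: (hausdorff1_image_ge (e := 1)) => // s t _ _ _.
  by rewrite giso mul1r.
by apply/le_hausdorff1/image_subset; exact: subset_itv_oo_cc.
Qed.

Lemma hausdorff1_chord (g : R -> R * R) (d : R) :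
    (forall s t, enorm (g s - g t) = `|s - t|) ->
    (forall t, enorm (g t) ^+ 2 = d ^+ 2 + t ^+ 2) ->
  hausdorff1 (range g `&` unit_disk R) = (2 * Num.sqrt (1 - d ^+ 2))%:E.
Proof.
move=> giso gnorm.
have disk t : (enorm (g t) <= 1) = (t ^+ 2 <= 1 - d ^+ 2).
  rewrite -ler_sqr ?nnegrE ?enorm_ge0// expr1n gnorm; lra.
have [d1|d1] := leP (d ^+ 2) 1; last first.
  have -> : range g `&` unit_disk R = set0.
    rewrite -subset0 => _ [[t _ <-]] /=; rewrite /unit_disk/= disk.
    by have := sqr_ge0 t; lra.
  (* The square root of a negative number is 0. *)
  by rewrite outer_measure0 ler0_sqrtr ?mulr0//; lra.
set h := Num.sqrt _; have h0 : 0 <= h by exact: sqrtr_ge0.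
have -> : range g `&` unit_disk R = g @` `[- h, h].
  have hE t : (t ^+ 2 <= 1 - d ^+ 2) = (- h <= t <= h).
    rewrite -ler_norml -[X in _ = X]ler_sqr ?nnegrE// real_normK ?num_real//.
    by rewrite sqr_sqrtr// subr_ge0.
  apply/seteqP; split => [_ [[t _ <-]]|_ [t /= + <-]].
    by rewrite /unit_disk/= disk hE => ht; exists t => //=; rewrite in_itv.
  by rewrite in_itv/= -hE -disk => ht; split; [exists t|].
rewrite hausdorff1_segment//; last lra.
by congr EFin; ring.
Qed.

End line.

(** * Radii with the prescribed distribution *)

Section radii.
Context {R : realType}.
Implicit Types a c s t : R.

Lemma sqrt_one_sub_sqr_le1 t : Num.sqrt (1 - t ^+ 2) <= 1.
Proof. by rewrite -[leRHS]sqrtr1 ler_wsqrtr// gerDl oppr_le0 sqr_ge0. Qed.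

(** The integral of [sqrt (1 - x^2)] over [0 <= x <= sin t], that is, the area
    of this slice of the upper half disk. *)
Definition cap_area t : R := (t + sin t * cos t) / 2.

Lemma is_derive_cap_area c t :
  is_derive t 1 (fun x => cap_area x - c * sin x) (cos t * (cos t - c)).
Proof.
have -> : (fun x => cap_area x - c * sin x) =
    2^-1 \*: (id + sin * cos) - c \*: sin.
  by apply/funext => x; rewrite /cap_area mulrC.
apply: (is_derive_eq (is_deriveB
  (is_deriveZ 2^-1 (is_deriveD (is_derive_id t 1)
    (is_deriveM (is_derive_sin t) (is_derive_cos t))))
  (is_deriveZ c (is_derive_sin t)))).
rewrite /GRing.scale/=; have := cos2Dsin2 t => cs.
transitivity (2^-1 * ((cos t ^+ 2 + sin t ^+ 2) + cos t ^+ 2 - sin t ^+ 2)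
              - c * cos t); first by rewrite cs; ring.
by field.
Qed.

(** The mean of [sqrt (1 - x^2)] over the interval from [sin s] to [sin t] lies
    strictly between its end values.  Both bounds are the mean value theorem for
    [cap_area - c * sin], whose derivative [cos x * (cos x - c)] has constant
    sign for [c = cos s] and for [c = cos t]. *)
Lemma cap_area_slope s t : 0 <= s < t -> t <= pi / 2 ->
  cos t * (sin t - sin s) < cap_area t - cap_area s
    < cos s * (sin t - sin s).
Proof.
move=> /andP[s0 st] tpi; have pi0 := @pi_gt0 R.
have mvt c : exists2 x, s < x < t &
    cap_area t - cap_area s - c * (sin t - sin s) =
    cos x * (cos x - c) * (t - s).
  have dF x := is_derive_cap_area c x.
  have [|x] := @MVT R _ _ s t st (fun x _ => dF x).
    by apply: derivable_within_continuous => x _; have [] := dF x.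
  by rewrite in_itv/= => xst /= H; exists x => //; rewrite -H; ring.
have cosx x : s < x < t -> [/\ 0 < cos x, cos t < cos x & cos x < cos s].
  move=> /andP[sx xt].
  split; first by apply: cos_gt0_pihalf; lra.
    by rewrite ltr_cos ?in_itv/=//; lra.
  by rewrite ltr_cos ?in_itv/=//; lra.
apply/andP; split; rewrite -subr_gt0.
  have [x /cosx[x0 tx xs] ->] := mvt (cos t).
  by rewrite !mulr_gt0// subr_gt0.
have [x /cosx[x0 tx xs] e] := mvt (cos s).
rewrite -oppr_lt0 opprB e -mulrA pmulr_rlt0// pmulr_llt0 ?subr_gt0//.
by rewrite subr_lt0.
Qed.

(** The radius of index [k] is the integral of [sqrt (1 - (x / a)^2)] over
    the interval from [k] to [k + 1], cut off at [a]: the truncated last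
    interval makes the sum exact when [a] is not an integer. *)
Lemma equidistributed_radii a : 0 < a ->
  exists (n : nat) (r : nat -> R),
    [/\ a <= n%:R,
        \sum_(0 <= k < n) r k = a * pi / 4,
        forall k, (k < n)%N -> 0 < r k < Num.sqrt (1 - (k%:R / a) ^+ 2),
        forall k, k.+1%:R <= a -> Num.sqrt (1 - (k.+1%:R / a) ^+ 2) < r k &
        forall j k, (j < k < n)%N -> r k < r j].
Proof.
move=> a0; have pi0 := @pi_gt0 R.
have [n an nmin] := ex_minnP (ex_intro (fun n => a <= n%:R) _
  (ltW (archi_boundP (ltW a0)))).
have ltna k : (k < n)%N -> k%:R < a.
  by move=> kn; rewrite ltNge; apply/negP => /nmin; rewrite leqNgt kn.
pose x k : R := Num.min k%:R a.
pose th k := asin (x k / a).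
pose r k := a * (cap_area (th k.+1) - cap_area (th k)).
have x0 k : 0 <= x k by rewrite le_min ler0n ltW.
have xa k : x k <= a by rewrite ge_min lexx orbT.
have xlt k : k%:R <= a -> x k = k%:R by move=> ?; rewrite /x minEle ifT.
have xa_itv k : -1 <= x k / a <= 1.
  by rewrite ler_pdivlMr// ler_pdivrMr// mul1r xa andbT mulN1r; have := x0 k; lra.
have sinth k : sin (th k) = x k / a by rewrite asinK// in_itv/=.
have costh k : cos (th k) = Num.sqrt (1 - (x k / a) ^+ 2) by rewrite cos_asin.
have th_pi k : - (pi / 2) <= th k <= pi / 2 by rewrite asin_geNpi2//= asin_lepi2.
have th0 k : 0 <= th k.
  rewrite leNgt -ltr_sin ?in_itv/=//; last lra.
  by rewrite sin0 sinth -leNgt divr_ge0// ltW.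
have xS k : k%:R < a -> x k < x k.+1.
  by move=> ka; rewrite (xlt _ (ltW ka)) lt_min ka andbT ltr_nat.
have slice k : k%:R < a ->
    cos (th k.+1) * (x k.+1 - x k) < r k < cos (th k) * (x k.+1 - x k).
  move=> ka; have th_lt : th k < th k.+1.
    rewrite -ltr_sin ?in_itv//= !sinth ltr_pM2r ?invr_gt0//; exact: xS.
  have := @cap_area_slope (th k) (th k.+1).
  rewrite th0 th_lt => /(_ isT); have /andP[_ ->] := th_pi k.+1 => /(_ isT).
  rewrite !sinth -mulrBl !mulrA ltr_pdivrMr// ltr_pdivlMr//.
  by rewrite ![_ * a]mulrC.
have r_gt k : k.+1%:R <= a -> Num.sqrt (1 - (k.+1%:R / a) ^+ 2) < r k.
  move=> ka; have ka' : k%:R < a by apply: lt_le_trans ka; rewrite ltr_nat.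
  have /andP[+ _] := slice k ka'; rewrite costh xlt// xlt; last exact: ltW.
  by rewrite -natr1 addrAC subrr add0r mulr1.
have r_lt k : k%:R < a -> r k < Num.sqrt (1 - (k%:R / a) ^+ 2).
  move=> ka; have /andP[_] := slice k ka; rewrite costh xlt; last exact: ltW.
  move=> /lt_le_trans; apply; rewrite ler_piMr ?sqrtr_ge0//.
  by rewrite lerBlDl natr1 ge_min lexx.
exists n, r; split=> //.
- have asin0 : asin 0 = 0 :> R.
    by have := @sinK R 0; rewrite sin0 in_itv/=; apply; lra.
  have asin1 : asin 1 = pi / 2 :> R.
    by have := @sinK R (pi / 2); rewrite sin_pihalf in_itv/=; apply; lra.
  have th_0 : th 0%N = 0 by rewrite /th xlt ?mul0r// ltW.
  have th_n : th n = pi / 2 by rewrite /th /x (min_idPr an) divff ?gt_eqF.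
  rewrite /r -mulr_sumr (telescope_sumr (fun k => cap_area (th k)) (leq0n n)).
  rewrite th_0 th_n.
  by rewrite /cap_area cos_pihalf sin0; field.
- move=> k kn; rewrite r_lt ?ltna// andbT.
  have /andP[+ _] := slice k (ltna _ kn); apply: le_lt_trans.
  rewrite mulr_ge0//; first by rewrite costh sqrtr_ge0.
  by rewrite subr_ge0 ltW// xS// ltna.
- move=> j k /andP[jk kn].
  have ka := ltna _ kn.
  have ja : j.+1%:R <= a by apply: le_trans (ltW ka); rewrite ler_nat.
  apply: lt_trans (r_lt _ ka) (le_lt_trans _ (r_gt _ ja)).
  rewrite ler_wsqrtr// lerD2l lerN2 ler_sqr ?nnegrE ?divr_ge0 ?ler0n ?(ltW a0)//.
  by rewrite ler_pM2r ?invr_gt0// ler_nat.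
Qed.

End radii.

(** * Counting intersections with concentric circles *)

Section counting.
Context {R : realType}.

Lemma counting_le_seq (A : set (R * R)) (e : nat -> R * R) n :
  A `<=` e @` `I_n -> (counting A <= n%:R%:E :> \bar R)%E.
Proof.
move=> Ae; have Afin : finite_set A.
  by apply: sub_finite_set Ae _; apply: finite_image; exact: finite_II.
rewrite /counting asboolT// lee_fin ler_nat; apply: geq_card_fset_set.
exact: card_le_trans (subset_card_le Ae) (card_image_le _ _).
Qed.

Lemma counting_ge_seq (A : set (R * R)) (e : nat -> R * R) n :
  e @` `I_n `<=` A -> {in `I_n &, injective e} ->
  (n%:R%:E <= counting A :> \bar R)%E.
Proof.
move=> eA einj; rewrite /counting; case: asboolP => [Afin|_]; last exact: leey.
rewrite lee_fin ler_nat; apply: leq_card_fset_set => //.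
apply: card_le_trans (subset_card_le eA).
by have /card_esym/card_eqPle[] := inj_card_eq einj.
Qed.

Section concentric_circles.
Context (g : R -> R * R) (d : R) (r : nat -> R) (n : nat).
Hypothesis d0 : 0 <= d.
Hypothesis giso : forall s t, enorm (g s - g t) = `|s - t|.
Hypothesis gnorm : forall t, enorm (g t) ^+ 2 = d ^+ 2 + t ^+ 2.
Hypothesis r0 : forall k, (k < n)%N -> 0 < r k.
Hypothesis r_dec : forall j k, (j < k < n)%N -> r k < r j.

Let X := range g `&` \bigcup_(k < n) circle (r k).

Let half_chord k := Num.sqrt (r k ^+ 2 - d ^+ 2).

(** If [d <= r k], the points of index [2 k] and [2 k + 1] are the
    intersections of the line with the circle of index [k]. *)
Let crossing i := g ((-1) ^+ odd i * half_chord i./2).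

Lemma counting_line_le m : (forall k, (m <= k < n)%N -> r k < d) ->
  (counting X <= m.*2%:R%:E :> \bar R)%E.
Proof.
move=> r_lt; apply: (@counting_le_seq _ crossing) => _ [[t _ <-]] [k /= kn gk].
have t2 : t ^+ 2 = r k ^+ 2 - d ^+ 2 by rewrite -gk gnorm; ring.
have km : (k < m)%N.
  rewrite ltnNge; apply/negP => mk; have : r k < d by rewrite r_lt// mk.
  have := sqr_ge0 t; rewrite t2 subr_ge0 ler_sqr ?nnegrE ?(ltW (r0 kn))//.
  by rewrite leNgt => /negP.
(* The sign of the parameter is the parity of the index. *)
exists ((t < 0)%R + k.*2)%N => /=.
  by case: (t < 0)%R; rewrite ?add1n ?add0n ?ltn_Sdouble ?ltn_double.
rewrite /crossing /half_chord half_bit_double -t2 sqrtr_sqr.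
by rewrite oddD odd_double addbF oddb mulr_sign_norm.
Qed.

Lemma counting_line_ge m : (m <= n)%N -> (forall k, (k < m)%N -> d < r k) ->
  (m.*2%:R%:E <= counting X :> \bar R)%E.
Proof.
move=> mn r_gt.
have lt_half i : (i < m.*2)%N -> (i./2 < m)%N by rewrite ltn_half_double.
have chord2 k : (k < m)%N -> 0 < r k ^+ 2 - d ^+ 2.
  by move=> km; rewrite subr_gt0 ltr_sqr ?nnegrE// ?r_gt// ltW// r0// (leq_trans km).
apply: (@counting_ge_seq _ crossing).
  move=> _ [i /= im <-]; split; first by exists ((-1) ^+ odd i * half_chord i./2).
  have km := lt_half _ im; have kn := leq_trans km mn.
  exists i./2 => //; apply/eqP.
  rewrite -(eqrXn2 (n := 2)) ?enorm_ge0 ?(ltW (r0 kn))//.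
  rewrite gnorm exprMn sqrr_sign mul1r sqr_sqrtr; last by rewrite ltW// chord2.
  by apply/eqP; ring.
move=> i j; rewrite !inE/= => im jm eij.
have {eij} : (-1) ^+ odd i * half_chord i./2 = (-1) ^+ odd j * half_chord j./2.
  apply/eqP; rewrite -subr_eq0 -normr_eq0 -giso; move: eij; rewrite /crossing => ->.
  by rewrite subrr /enorm/= expr0n/= addr0 sqrtr0.
have ki := lt_half _ im; have kj := lt_half _ jm.
have hi : 0 < half_chord i./2 by rewrite sqrtr_gt0 chord2.
have hj : 0 < half_chord j./2 by rewrite sqrtr_gt0 chord2.
move=> e.
have oddE : odd i = odd j.
  by case: (odd i) (odd j) e => [] []; rewrite ?expr1 ?expr0 ?mulN1r ?mul1r//; lra.
have {e} : half_chord i./2 = half_chord j./2.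
  by move: e; rewrite oddE => /mulfI; apply; rewrite signr_eq0.
move=> /(congr1 (fun x => x ^+ 2)).
rewrite !sqr_sqrtr; [|by rewrite ltW// chord2..].
move=> /addIr /eqP; rewrite eqrXn2 ?(ltW (r0 (leq_trans _ mn)))// => /eqP rE.
have : i./2 = j./2.
  case: (ltngtP i./2 j./2) => // lt; have := @r_dec _ _.
    by move=> /(_ i./2 j./2); rewrite lt (leq_trans kj mn) rE ltxx => /(_ isT).
  by move=> /(_ j./2 i./2); rewrite lt (leq_trans ki mn) rE ltxx => /(_ isT).
by move=> halfE; rewrite -(odd_double_half i) oddE halfE odd_double_half.
Qed.

End concentric_circles.

End counting.

(** * Circles realizing the distribution *)

Theorem theorem1 (R : realType) (L : R) (hL : 0 < L) :
  exists S : set (R * R),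
    [/\ rectifiable S,
        S `<=` unit_disk R,
        hausdorff1 S = L%:E &
        forall l : set (R * R), is_line l ->
          (`| counting (l `&` S)
              - (2 * L / pi ^+ 2)%:E * hausdorff1 (l `&` unit_disk R) |
           <= 100%:E)%E].
Proof.
have pi0 := @pi_gt0 R.
set a := 2 * L / pi ^+ 2.
have a0 : 0 < a by rewrite divr_gt0 ?mulr_gt0 ?exprn_gt0.
have [n [r [an r_sum r_itv r_gt r_dec]]] := equidistributed_radii a0.
have r0 k : (k < n)%N -> 0 < r k by move=> /r_itv/andP[].
have r_lt k : (k < n)%N -> r k < Num.sqrt (1 - (k%:R / a) ^+ 2).
  by move=> /r_itv/andP[].
pose S := \bigcup_(k < n) circle (r k).
have HS : hausdorff1 S = L%:E.
  rewrite hausdorff1_concentric// r_sum; congr EFin.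
  rewrite /a; move: (@pi R) pi0 => q q0.
  by field; exact: lt0r_neq0.
exists S; split => //.
- split; rewrite ?HS ?ltry//.
    rewrite /S bigcup_mkord.
    exact: (@caratheodory_measurable_bigsetU _ _ (@hausdorff1 R)
      (fun k => circle (r k)) (fun k => caratheodory_circle (r k)) n).
  (* There are finitely many circles; the remaining curves are constant. *)
  exists (fun k => if (k < n)%N then circle_param (r k) else cst 0); split.
    move=> k; case: ifP => kn.
      exists (r k) => s t; apply: circle_param_lipschitz; exact/ltW/r0.
    by exists 0 => s t; rewrite subrr /enorm/= expr0n/= addr0 sqrtr0 mul0r.
  rewrite -[RHS](outer_measure0 (@hausdorff1 R)); congr hausdorff1.
  rewrite -subset0 => p [[k /= kn pk] []]; exists k => //; rewrite kn.
  by have [t _ <-] := circle_param_surj (r0 _ kn) pk; exists t.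
- move=> p [k /= kn]; rewrite /unit_disk/= => ->.
  apply/ltW/(lt_le_trans (r_lt _ kn)).
  exact: sqrt_one_sub_sqr_le1.
move=> l /line_param[g [d [d0 lE giso gnorm]]].
rewrite lE (hausdorff1_chord giso gnorm) -EFinM.
(* Twice [N] is the expected count; it is 0 when the line misses the disk. *)
pose N := a * Num.sqrt (1 - d ^+ 2).
have N0 : 0 <= N by rewrite mulr_ge0 ?sqrtr_ge0// ltW.
have -> : a * (2 * Num.sqrt (1 - d ^+ 2)) = 2 * N by rewrite /N; ring.
set m := Num.truncn N.
have /andP[mN Nm] : m%:R <= N < m.+1%:R by exact: truncn_itv.
have low : (m.*2%:R%:E <= counting (range g `&` S) :> \bar R)%E.
  apply: (counting_line_ge d0 giso gnorm r0 r_dec).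
    rewrite -(ler_nat R); apply: le_trans mN _; apply: le_trans _ an.
    by rewrite ler_piMr ?(ltW a0)// sqrt_one_sub_sqr_le1.
  move=> k km; have kN : k.+1%:R <= N by apply: le_trans mN; rewrite ler_nat.
  have d1 : 0 <= 1 - d ^+ 2.
    rewrite leNgt; apply/negP => /ltW /ler0_sqrtr s0.
    by move: kN; rewrite /N s0 mulr0 leNgt ltr0Sn.
  have ka : k.+1%:R / a <= Num.sqrt (1 - d ^+ 2) by rewrite ler_pdivrMr// mulrC.
  apply: le_lt_trans (r_gt k _).
    rewrite -[leLHS](ger0_norm d0) -sqrtr_sqr ler_wsqrtr//.
    rewrite lerBrDr -lerBrDl -[leRHS]sqr_sqrtr//.
    by rewrite ler_sqr ?nnegrE ?sqrtr_ge0// divr_ge0// ltW.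
  by apply: le_trans kN _; rewrite ler_piMr ?(ltW a0)// sqrt_one_sub_sqr_le1.
have up : (counting (range g `&` S) <= m.+1.*2%:R%:E :> \bar R)%E.
  apply: (counting_line_le d0 gnorm r0) => k /andP[mk kn].
  apply: lt_le_trans (r_lt _ kn) _.
  have kN : N <= k%:R by rewrite (le_trans (ltW Nm))// ler_nat.
  rewrite -[leRHS](ger0_norm d0) -sqrtr_sqr ler_wsqrtr//.
  rewrite lerBlDr -lerBlDl; have [d1|d1] := leP (1 - d ^+ 2) 0.
    by rewrite (le_trans d1)// sqr_ge0.
  rewrite -[leLHS]sqr_sqrtr; last exact: ltW.
  rewrite ler_sqr ?nnegrE ?sqrtr_ge0//; last by rewrite divr_ge0// ltW.
  by rewrite ler_pdivlMr// mulrC.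
move: low up; case: (counting _) => [c| |] //; rewrite !lee_fin => low up.
rewrite ler_norml.
move: low up mN Nm; rewrite -!muln2 !natrM -natr1; lra.
Qed.
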